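(* Let $n$ be sufficiently large, and let $p_1,\ldots,p_n$ be points picked uniformly and independently at random from $[0,1]^2$, revealed to a player one at a time in this order; the player knows $n$ in advance and must irrevocably decide, when $p_i$ is revealed (and without knowledge of later points), whether to pick it; exactly one point may be picked. For $i\le n$ let $P_i=\{p_1,\ldots,p_i\}$ and $P=P_n$. Consider the following strategy, with parameters $f=c\sqrt{n}\log n$ (for a constant $c>0$) and a radius $R$: ignore the first $n-f$ points, and then pick the first point $p_i$ with $i>n-f$ such that the disk $D_i$ of radius $R$ centered at $p_i$ (with respect to the torus distance) contains no point of $P_i$ other than $p_i$. Then there are a sufficiently large constant $c$ and a radius $R=\Theta(\sqrt{(\log n)/n})$ such that, with probability at least $1-O\bigl(\frac{\log^2 n}{\sqrt{n}}\bigr)$, the player picks a point whose cell in the Voronoi diagram of $P$ has area $\Omega(\nabla)$, where $\nabla=\frac{\log n}{n}$, while the largest cell in the Voronoi diagram of $P$ has area $O(\nabla)$. That is, the strategy is $O(1)$-competitive with the optimal choice made with full knowledge of $P$ (the site of the largest cell).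
   Context: All logarithms are natural. The unit square $[0,1]^2$ is considered with the torus topology: for $x,y\in[0,1]$ let $d_T(x,y)=\min(|x-y|,1-|x-y|)$, and for $p,q\in[0,1]^2$ the torus distance is $d_T(p,q)=\sqrt{d_T(p_1,q_1)^2+d_T(p_2,q_2)^2}$. All Voronoi diagrams are computed with respect to this torus distance and restricted to $[0,1]^2$; the cell of a site $p\in P$ is the set of points of $[0,1]^2$ whose torus distance to $p$ is at most their torus distance to every other site of $P$. The player's payoff is the area of the cell of the picked point in the final Voronoi diagram of all of $P$. *)

(* Defs.v *)
From HB Require Import structures.
From mathcomp Require Import all_boot all_order all_algebra.
From mathcomp Require Import all_classical all_reals all_analysis.
Set Implicit Arguments. Unset Strict Implicit. Unset Printing Implicit Defensive.
Import Order.TTheory GRing.Theory Num.Theory.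
Import numFieldNormedType.Exports.
Local Open Scope classical_set_scope.
Local Open Scope ring_scope.

Section Voronoi.
Variable R : realType.

Definition dT1 (x y : R) : R := Num.min `|x - y| (1 - `|x - y|).

Definition dT (p q : R * R) : R :=
  Num.sqrt (dT1 p.1 q.1 ^+ 2 + dT1 p.2 q.2 ^+ 2).

Definition unit_square : set (R * R) :=
  [set q | 0 <= q.1 <= 1 /\ 0 <= q.2 <= 1].

(* the i-th point (0-based) of the configuration s = [:: p_1; ...; p_n] *)
Definition pt (s : seq (R * R)) (i : nat) : R * R := nth (0, 0) s i.

Definition voronoi_cell (s : seq (R * R)) (i : nat) : set (R * R) :=
  [set q | unit_square q /\
           forall j, (j < size s)%N -> dT q (pt s i) <= dT q (pt s j)].

Definition area (A : set (R * R)) : \bar R :=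
  ((@lebesgue_measure R) \x (@lebesgue_measure R)) A.

Definition cell_area (s : seq (R * R)) (i : nat) : \bar R :=
  area (voronoi_cell s i).

Fixpoint iter_unif (k : nat) (F : seq (R * R) -> \bar R) : \bar R :=
  match k with
  | 0 => F [::]
  | k'.+1 =>
      (\int[@lebesgue_measure R]_(x in `[0%R, 1%R])
        \int[@lebesgue_measure R]_(y in `[0%R, 1%R])
          iter_unif k' (fun s => F ((x, y) :: s)))%E
  end.

(* probability that n points picked uniformly and independently from
   [0,1]^2 satisfy E (product uniform measure, computed via Tonelli as an
   iterated integral of the indicator of E) *)
Definition prob_unif (n : nat) (E : seq (R * R) -> Prop) : \bar R :=
  iter_unif n (fun s => (if `[< E s >] then 1 else 0)%:E).

(* Stopping rule, 1-based index i (1 <= i <= n), with 0-based point pt s (i-1):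
   i > n - f, and the closed torus disk of radius rad around p_i contains no
   point p_j, j < i. *)
Definition candidate (n : nat) (f rad : R) (s : seq (R * R)) (i : nat) : Prop :=
  (0 < i)%N /\ (i <= n)%N /\ n%:R - f < i%:R /\
  forall j, (0 < j)%N -> (j < i)%N -> rad < dT (pt s j.-1) (pt s i.-1).

Definition picks (n : nat) (f rad : R) (s : seq (R * R)) (i : nat) : Prop :=
  candidate n f rad s i /\ forall j, (j < i)%N -> ~ candidate n f rad s j.

Definition good_event (n : nat) (f rad alpha beta : R) (s : seq (R * R)) : Prop :=
  (exists i, picks n f rad s i /\
     (alpha * (ln n%:R / n%:R))%:E <= cell_area s i.-1)%E /\
  (forall j, (j < n)%N -> (cell_area s j <= (beta * (ln n%:R / n%:R))%:E)%E).

End Voronoi.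

(* Main.v *)
(* Cut the torus into L x L cells, with 1 / L of order sqrt (log n / n), group them
   into 3 x 3 blocks, and let the radius be 1 / (2 L). A point that falls in the
   central cell of a block containing no earlier point is a candidate. The number
   of empty blocks is a Markov chain with explicit first two moments, so by
   Chebyshev many blocks are still empty after n - f points, and one of their
   centres is then hit during the last f rounds with overwhelming probability.
   Once a point is picked, each later point falls in one of the at most 25 cells
   near it with probability O(1 / L^2), which costs O(f log n / n) in total and is
   the dominant error term; otherwise a disk of radius of order 1 / L around the
   picked point stays empty. Coarser cells, 24 times as large, are all occupied
   with high probability, which bounds every Voronoi cell from above.

   Whether a point is picked is not a function of the cells. It does not matter:
   processing the points one at a time, the lower bound on the conditional success
   probability is the same whether or not the current point gets picked and only
   depends on the cells, so no event has to be shown measurable. *)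
Require Import Defs.
From HB Require Import structures.
From mathcomp Require Import all_boot all_order all_algebra.
From mathcomp Require Import all_classical all_reals all_analysis.
From mathcomp Require Import measurable_realfun.
From mathcomp Require Import ring lra zify.
Set Implicit Arguments. Unset Strict Implicit. Unset Printing Implicit Defensive.
Import Order.TTheory GRing.Theory Num.Theory.
Import numFieldNormedType.Exports.
Local Open Scope ring_scope.

(** * Sequences of independent uniform elements of a finite type *)

Section DiscreteExpectation.
Variables (R : realType) (C : finType).
Hypothesis C_gt0 : (0 < #|C|)%N.

(** Expectation over [k] independent uniform letters. The first letter is averaged outermost,
    exactly as [iter_unif] integrates the first point outermost, so both unfold in parallel. *)
Fixpoint dE (k : nat) (F : seq C -> R) : R :=
  if k is k'.+1 then (\sum_c dE k' (fun w => F (c :: w))) / #|C|%:R else F [::].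

Let CR : 0 < #|C|%:R :> R. Proof. by rewrite ltr0n. Qed.

Lemma avg_cst (a : R) : (\sum_(c : C) a) / #|C|%:R = a.
Proof. by rewrite sumr_const -[a *+ _]mulr_natr mulfK// gt_eqF. Qed.

Lemma le_avg (f g : C -> R) : (forall c, f c <= g c) ->
  (\sum_c f c) / #|C|%:R <= (\sum_c g c) / #|C|%:R.
Proof. by move=> fg; rewrite ler_pM2r ?invr_gt0//; apply: ler_sum => c _. Qed.

Lemma le_dE k F G : (forall w, size w = k -> F w <= G w) -> dE k F <= dE k G.
Proof.
elim: k F G => [|k IH] F G FG /=; first exact: FG.
by apply: le_avg => c; apply: IH => w sw; apply: FG; rewrite /= sw.
Qed.

Lemma eq_dE k F G : (forall w, size w = k -> F w = G w) -> dE k F = dE k G.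
Proof. by move=> FG; apply/le_anti/andP; split; apply: le_dE => w /FG ->. Qed.

Lemma dE_cst k a : dE k (fun=> a) = a.
Proof. by elim: k => //= k IH; rewrite IH avg_cst. Qed.

Lemma dE_ge0 k F : (forall w, 0 <= F w) -> 0 <= dE k F.
Proof. by move=> F0; rewrite -(dE_cst k 0); apply: le_dE. Qed.

Lemma dED k F G : dE k (fun w => F w + G w) = dE k F + dE k G.
Proof.
elim: k F G => //= k IH F G; rewrite -mulrDl -big_split/=.
by congr (_ / _); apply: eq_bigr => c _; exact: IH.
Qed.

Lemma dEZ k a F : dE k (fun w => a * F w) = a * dE k F.
Proof.
elim: k F => //= k IH F; rewrite mulrA mulr_sumr.
by congr (_ / _); apply: eq_bigr => c _; exact: IH.
Qed.

Lemma dE_cat k l F :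
  dE (k + l) F = dE k (fun u => dE l (fun v => F (u ++ v))).
Proof.
elim: k F => //= k IH F.
by congr (_ / _); apply: eq_bigr => c _; exact: IH.
Qed.

(** * Occupancy of equal-sized blocks by a uniform random word *)

Section Occupancy.
Variables (B : finType) (blk : C -> B) (r : nat).
Hypothesis r_gt0 : (0 < r)%N.
Hypothesis blk_card : forall b, #|[set c | blk c == b]| = r.

Definition hit (A : {set B}) (w : seq C) : {set B} :=
  foldl (fun A c => blk c |: A) A w.

Lemma mem_hit A w b : (b \in hit A w) = (b \in A) || (b \in map blk w).
Proof.
elim: w A => [|c w IH] A /=; first by rewrite orbF.
by rewrite IH in_setU1 in_cons orbCA orbA.
Qed.

Lemma hit_cat A u v : hit A (u ++ v) = hit (hit A u) v.
Proof. exact: foldl_cat. Qed.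

Lemma card_blk : #|C| = (#|B| * r)%N.
Proof.
rewrite -sum1_card (partition_big blk predT)//=.
rewrite (eq_bigr (fun=> r)) ?sum_nat_const// => b _.
by rewrite -(blk_card b) -sum1_card; apply: eq_bigl => c; rewrite inE.
Qed.

Lemma sum_blk (G : B -> R) : \sum_c G (blk c) = r%:R * \sum_b G b.
Proof.
rewrite (partition_big blk predT)//= mulr_sumr; apply: eq_bigr => b _.
rewrite (eq_bigr (fun=> G b)) => [|c /eqP->//].
rewrite sumr_const -[LHS]mulr_natl; congr (_%:R * _).
by rewrite -(blk_card b); apply: eq_card => c; rewrite inE.
Qed.

Definition empties (A : {set B}) : nat := #|~: A|.

Lemma empties_setU1 A b :
  empties (b |: A) = if b \in A then empties A else (empties A).-1.
Proof.
rewrite /empties; case: ifPn => bA.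
  congr #|pred_of_set _|; apply/setP => x; rewrite !inE negb_or.
  by case: eqP => // ->; rewrite bA.
have -> : ~: (b |: A) = ~: A :\ b by apply/setP => x; rewrite !inE negb_or.
by rewrite (cardsD1 b (~: A)) inE bA.
Qed.

(** One step of the Markov chain: blocks have equal size, so a uniform letter gives a uniform block,
    which is new with probability [e / #|B|]. At [e = 0] the truncated [e.-1] is multiplied by 0. *)
Lemma avg_empties (g : nat -> R) A (e := empties A) :
  (\sum_c g (empties (blk c |: A))) / #|C|%:R =
  g e + e%:R / #|B|%:R * (g e.-1 - g e).
Proof.
have BR : 0 < #|B|%:R :> R.
  by rewrite ltr0n; move: C_gt0; rewrite card_blk muln_gt0 => /andP[].
have rR : 0 < r%:R :> R by rewrite ltr0n.
rewrite (sum_blk (fun b => g (empties (b |: A)))) card_blk.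
have -> : \sum_b g (empties (b |: A)) = #|A|%:R * g e + e%:R * g e.-1.
  rewrite (bigID (mem A))/=; congr (_ + _).
    rewrite (eq_bigr (fun=> g e)) => [|b bA]; last by rewrite empties_setU1 bA.
    by rewrite sumr_const mulr_natl.
  rewrite (eq_bigr (fun=> g e.-1)) => [|b bA]; last by rewrite empties_setU1 (negbTE bA).
  rewrite sumr_const mulr_natl; congr (_ *+ _).
  by rewrite /e /empties; apply: eq_card => b; rewrite !inE.
have -> : #|A|%:R = #|B|%:R - e%:R :> R.
  by rewrite -(cardsC A) natrD addrK.
rewrite natrM; field; by rewrite !gt_eqF.
Qed.

Let m : R := #|B|%:R.

(** The identity [e] is an eigenfunction of the one-step operator, with eigenvalue [1 - 1 / m]. *)
Lemma dE_empties k A :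
  dE k (fun w => (empties (hit A w))%:R) = (empties A)%:R * (1 - m^-1) ^+ k.
Proof.
elim: k A => [|k IH] A /=; first by rewrite mulr1.
under eq_bigr do rewrite IH.
rewrite (avg_empties (fun e => e%:R * (1 - m^-1) ^+ k)) exprS -/m.
case: (empties A) => [|e]; first by rewrite !mul0r addr0.
by rewrite /= -natr1; ring.
Qed.

(** The factorial moment is used instead of the square because [e (e - 1)] is again an
    eigenfunction, with eigenvalue [1 - 2 / m]. *)
Lemma dE_empties2 k A :
  dE k (fun w => (empties (hit A w))%:R * ((empties (hit A w))%:R - 1)) =
  (empties A)%:R * ((empties A)%:R - 1) * (1 - 2 / m) ^+ k.
Proof.
elim: k A => [|k IH] A /=; first by rewrite mulr1.
under eq_bigr do rewrite IH.
rewrite (avg_empties (fun e => e%:R * (e%:R - 1) * (1 - 2 / m) ^+ k)) exprS -/m.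
case: (empties A) => [|e]; first by rewrite !mul0r addr0.
by rewrite /= -natr1; ring.
Qed.

(** Since [1 - 2 / m <= (1 - 1 / m) ^ 2], the second factorial moment is at most [mu ^ 2], which
    leaves at most the mean. *)
Lemma variance_empties k (mu := m * (1 - m^-1) ^+ k) : 2 <= m ->
  dE k (fun w => ((empties (hit finset.set0 w))%:R - mu) ^+ 2) <= mu.
Proof.
move=> m2; have m0 : 0 < m by lra.
have e0 : (empties finset.set0)%:R = m by rewrite /empties finset.setC0 cardsT.
rewrite (@eq_dE _ _ (fun w =>
   (empties (hit finset.set0 w))%:R * ((empties (hit finset.set0 w))%:R - 1) + ((1 - 2 * mu) * (empties (hit finset.set0 w))%:R + mu ^+ 2))); last by move=> w _; ring.
rewrite dED dED dE_empties2 dEZ dE_cst dE_empties e0 -/mu.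
have : (1 - 2 / m) ^+ k <= ((1 - m^-1) ^+ k) ^+ 2.
  rewrite -exprM mulnC exprM lerXn2r ?nnegrE ?sqr_ge0//.
    by rewrite subr_ge0 ler_pdivrMr// mul1r.
  have := sqr_ge0 m^-1; rewrite !expr2; nra.
have : 0 <= (1 - 2 / m) ^+ k by rewrite exprn_ge0// subr_ge0 ler_pdivrMr// mul1r.
rewrite /mu; set a := _ ^+ k; set b := _ ^+ k; nra.
Qed.

(** Chebyshev: on this event the deviation exceeds [mu / 2], so the indicator is at most
    [4 / mu ^ 2] times the squared deviation. *)
Lemma dE_few_empties k (mu := m * (1 - m^-1) ^+ k) : 2 <= m ->
  dE k (fun w => ((empties (hit finset.set0 w))%:R < mu / 2)%R%:R) <= 4 / mu.
Proof.
move=> m2; have mu0 : 0 < mu.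
  rewrite mulr_gt0 ?exprn_gt0//; first by lra.
  by rewrite subr_gt0 invf_lt1; lra.
apply: (@le_trans _ _ (dE k (fun w => 4 / mu ^+ 2 * ((empties (hit finset.set0 w))%:R - mu) ^+ 2))).
  apply: le_dE => w _; set e := (empties _)%:R.
  case: ltP => emu /=; last by rewrite mulr_ge0 ?divr_ge0 ?sqr_ge0.
  by rewrite mulrAC ler_pdivlMr ?exprn_gt0// mul1r !expr2; nra.
rewrite dEZ; apply: (@le_trans _ _ (4 / mu ^+ 2 * mu)).
  by rewrite ler_wpM2l ?divr_ge0 ?sqr_ge0//; exact: variance_empties.
rewrite le_eqVlt; apply/orP; left; apply/eqP; field; exact: lt0r_neq0.
Qed.

Lemma dE_some_empty k :
  dE k (fun w => (empties (hit finset.set0 w) != 0)%N%:R) <= m * (1 - m^-1) ^+ k.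
Proof.
have e0 : (empties finset.set0)%:R = m by rewrite /empties finset.setC0 cardsT.
rewrite -[X in _ <= X * _]e0 -dE_empties; apply: le_dE => w _; rewrite ler_nat.
by case: (empties _).
Qed.

Variable cen : B -> C.
Hypothesis cenK : cancel cen blk.

(** Discrete stand-in for the absence of candidates, with [A] the blocks occupied so far. A letter
    at the centre of a fresh block forces a candidate, but candidates may also arise otherwise. *)
Fixpoint no_cand (A : {set B}) (w : seq C) : bool :=
  if w is c :: w' then
    ~~ ((c == cen (blk c)) && (blk c \notin A)) && no_cand (blk c |: A) w'
  else true.

(** Each round uses up at most one empty block, so at least [u] blocks are empty in every round, and
    each round hits one of their centres with probability at least [u / #|C|]. *)
Lemma dE_no_cand k A (u : R) : 0 <= u -> u + k%:R <= (empties A)%:R ->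
  dE k (fun w => (no_cand A w)%:R) <= (1 - u / #|C|%:R) ^+ k.
Proof.
move=> u0; elim: k A => [|k IH] A uA; first by rewrite /= expr0.
have eC : ((empties A) <= #|C|)%N.
  rewrite card_blk (leq_trans (max_card _))// leq_pmulr//.
have uC : u / #|C|%:R <= 1.
  rewrite ler_pdivrMr// mul1r; apply: le_trans (_ : (empties A)%:R <= _).
    by apply: le_trans uA; rewrite lerDl.
  by rewrite ler_nat.
have q0 : 0 <= (1 - u / #|C|%:R) ^+ k by rewrite exprn_ge0// subr_ge0.
pose S := [set c | (c == cen (blk c)) && (blk c \notin A)].
have SA : ((empties A) <= #|S|)%N.
  rewrite /empties -(card_imset _ (can_inj cenK)); apply: subset_leq_card.
  by apply/fintype.subsetP => _ /imsetP[b bA ->]; rewrite !inE cenK eqxx/=; move: bA; rewrite inE.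
apply: (@le_trans _ _ ((\sum_c (c \notin S)%:R * (1 - u / #|C|%:R) ^+ k) / #|C|%:R)).
  apply: le_avg => c; rewrite /= [c \in S]inE.
  case: (_ && _) => /=; first by rewrite mul0r -[leRHS](dE_cst k); apply: le_dE.
  rewrite mul1r.
  apply: IH; rewrite empties_setU1; move: uA; rewrite -natr1 => uA.
  case: ifP => _; first by lra.
  case: (empties A) uA => [|e]; rewrite -?natr1/=; last by lra.
  by have := ler0n R k; lra.
rewrite -mulr_suml exprS -mulrAC ler_wpM2r//.
have SC : (\sum_c (c \notin S) = #|~: S|)%N.
  by rewrite -sum1_card [RHS]big_mkcond/=; apply: eq_bigr => c _; rewrite !inE; case: (_ && _).
have -> : \sum_c (c \notin S)%:R = #|C|%:R - #|S|%:R :> R.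
  by rewrite -natr_sum SC -(cardsC S) natrD addrC addKr.
rewrite mulrBl divff ?gt_eqF// lerD2l lerN2 ler_pM2r ?invr_gt0//.
apply: le_trans (_ : (empties A)%:R <= _); last by rewrite ler_nat.
by apply: le_trans uA; rewrite lerDl.
Qed.

(* By Chebyshev at least [mu / 2] blocks are empty after [N1] points, and the
   [k <= mu / 4] later points cannot use up half of them. *)
Lemma dE_no_cand_late N1 k (mu := m * (1 - m^-1) ^+ N1) :
  2 <= m -> k%:R <= mu / 4 ->
  dE (N1 + k) (fun w => (no_cand (hit finset.set0 (take N1 w)) (drop N1 w))%:R) <=
  4 / mu + (1 - mu / 4 / #|C|%:R) ^+ k.
Proof.
move=> m2 kmu.
have m0 : 0 < m by exact: lt_le_trans m2.
have mu0 : 0 <= mu.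
  rewrite mulr_ge0 ?exprn_ge0 ?(ltW m0)//.
  by rewrite subr_ge0 invf_le1//; apply: le_trans m2; rewrite ler1n.
rewrite dE_cat.
apply: le_trans (lerD (dE_few_empties N1 m2) (lexx _)).
rewrite -/mu -[X in _ <= _ + X](dE_cst N1) -dED; apply: le_dE => w sw.
rewrite (@eq_dE _ _ (fun v => (no_cand (hit finset.set0 w) v)%:R)); last first.
  by move=> v _; rewrite -sw take_size_cat// drop_size_cat.
have [emu|emu] := ltP.
  rewrite ler_wpDr//; last first.
    rewrite -[leRHS](dE_cst k); apply: le_dE => v _.
    by rewrite lern1; case: no_cand.
  rewrite exprn_ge0// subr_ge0 ler_pdivrMr// mul1r.
  apply: (@le_trans _ _ m); last first.
    by rewrite ler_nat card_blk leq_pmulr.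
  have : (1 - m^-1) ^+ N1 <= 1.
    rewrite exprn_ile1// ?subr_ge0 ?invf_le1 ?gerBl ?invr_ge0; lra.
  by rewrite /mu; set q := _ ^+ _; nra.
rewrite add0r; apply: dE_no_cand; first by lra.
by lra.
Qed.

End Occupancy.
End DiscreteExpectation.

(** * Integrals over the unit square *)

(* No measurability is needed, because the integral of a nonnegative function is
   defined as a supremum over the simple functions below it. *)
Lemma ge0_le_integral_nomeas d (T : measurableType d) (R : realType)
    (mu : {measure set T -> \bar R}) (D : set T) (f g : T -> \bar R) :
  (forall x, D x -> (0 <= f x)%E) -> (forall x, D x -> (f x <= g x)%E) ->
  (\int[mu]_(x in D) f x <= \int[mu]_(x in D) g x)%E.
Proof.
move=> f0 fg.
have g0 x : D x -> (0 <= g x)%E by move=> Dx; rewrite (le_trans (f0 _ Dx)) ?fg.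
rewrite !ge0_integralE//; apply: le_ereal_sup => _ [h hf <-].
by exists h => // x; apply: (le_trans (hf x)); exact: lee_restrict.
Qed.

Section GridIntegral.
Variable R : realType.
Local Open Scope classical_set_scope.

(** Holds for arbitrary sets because [lebesgue_measure] is built from an outer measure; this lets
    Voronoi cells be compared directly with rectangles. *)
Lemma lebesgue_measure_le (A B : set R) : A `<=` B ->
  (@lebesgue_measure R A <= @lebesgue_measure R B)%E.
Proof.
by move=> AB; rewrite /lebesgue_measure /lebesgue_stieltjes_measure
  /measure_extension; exact: le_outer_measure.
Qed.

Lemma area_le (A B : set (R * R)) : A `<=` B -> (area A <= area B)%E.
Proof.
move=> AB; rewrite /area /product_measure1; apply: ge0_le_integral_nomeas => //= x _.
by apply: lebesgue_measure_le => y; rewrite /xsection /= !inE; exact: AB.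
Qed.

Definition cell1 (L i : nat) (x : R) := i%:R / L%:R <= x < i.+1%:R / L%:R.

Lemma cell1_inj L i j x : (0 < L)%N -> cell1 L i x -> cell1 L j x -> i = j.
Proof.
move=> L0 /andP[a b] /andP[c d]; have LR : 0 < L%:R :> R by rewrite ltr0n.
move: (le_lt_trans a d) (le_lt_trans c b).
by rewrite !ltr_pM2r ?invr_gt0// !ltr_nat; lia.
Qed.

(** The function [h] dominates a step function, which is measurable and has a computable
    integral. *)
Lemma integral_cell1_ge (L : nat) (g : 'I_L -> R) (h : R -> \bar R) : (0 < L)%N ->
  (forall x, (0 <= h x)%E) ->
  (forall (i : 'I_L) x, cell1 L i x -> ((g i)%:E <= h x)%E) ->
  (((\sum_i g i) / L%:R)%:E <= \int[@lebesgue_measure R]_(x in `[0%R, 1%R]) h x)%E.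
Proof.
move=> L0 h0 gh; have LR : 0 < L%:R :> R by rewrite ltr0n.
(* The bound [g] may be negative; as [h] is nonnegative it also dominates the positive part of
   [g]. *)
pose g' i := Num.max 0 (g i).
have g'0 i : 0 <= g' i by rewrite le_max lexx.
pose I (i : nat) : set R := `[i%:R / L%:R, i.+1%:R / L%:R[%classic.
have mI i : measurable (I i) by exact: measurable_itv.
have muI (i : 'I_L) : @lebesgue_measure R (I i `&` `[0%R, 1%R]) = (L%:R^-1)%:E.
  have -> : I i `&` `[0%R, 1%R] = I i.
    apply: setIidl => x; rewrite /I /= !in_itv/= => /andP[ax xb]; apply/andP; split.
      by apply: le_trans ax; rewrite divr_ge0.
    apply/ltW; apply: (lt_le_trans xb); rewrite ler_pdivrMr// mul1r ler_nat.
    exact: ltn_ord.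
  rewrite lebesgue_measure_itv/= lte_fin ltr_pM2r ?invr_gt0// ltr_nat ltnSn.
  by rewrite -EFinB -mulrBl -natrB// subSnn div1r.
apply: (@le_trans _ _ (\int[@lebesgue_measure R]_(x in `[0%R, 1%R])
   \sum_(i < L) ((g' i)%:E * (\1_(I i) x)%:E))%E); last first.
  apply: ge0_le_integral_nomeas => x _.
    by apply: sume_ge0 => i _; rewrite mule_ge0// lee_fin.
  have [[i ix]|nx] := pselect (exists i : 'I_L, cell1 L i x).
    rewrite (bigD1 i)//= big1 => [|j ji].
      rewrite adde0 indicE mem_set ?mule1; last by rewrite /I /= in_itv.
      by rewrite /g' /Num.max; case: ifP => // _; exact: gh ix.
    rewrite indicE memNset ?mule0// /I /= in_itv/= => jx.
    by move/negP: ji; apply; apply/eqP/val_inj; apply: (cell1_inj L0 jx ix).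
  (* Outside all half-open cells, as at the point 1, the step function vanishes. *)
  rewrite big1// => i _; rewrite indicE memNset ?mule0// /I /= in_itv/= => ix.
  by apply: nx; exists i.
rewrite ge0_integral_sum//; first last.
- by move=> i x _; rewrite mule_ge0// lee_fin.
- move=> i; apply: measurable_funeM; apply/measurable_EFinP.
  by apply: measurable_indic; exact: mI.
rewrite (eq_bigr (fun i : 'I_L => (g' i / L%:R)%:E)); last first.
  move=> i _; rewrite ge0_integralZl//.
  - rewrite integral_indic//; last exact: mI.
    by rewrite [X in (_ * X)%E](muI i) EFinM.
  - by apply/measurable_EFinP; apply: measurable_indic; exact: mI.
  - by rewrite lee_fin.
rewrite sumEFin lee_fin -mulr_suml ler_pM2r ?invr_gt0//.
by apply: ler_sum => i _; rewrite le_max lexx orbT.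
Qed.

Definition incell (L : nat) (c : 'I_L * 'I_L) (p : R * R) :=
  cell1 L c.1 p.1 /\ cell1 L c.2 p.2.

Lemma integral_incell_ge (L : nat) (g : 'I_L * 'I_L -> R) (h : R -> R -> \bar R) :
  (0 < L)%N -> (forall x y, (0 <= h x y)%E) ->
  (forall c x y, incell c (x, y) -> ((g c)%:E <= h x y)%E) ->
  (((\sum_c g c) / #|{: 'I_L * 'I_L}|%:R)%:E <=
    \int[@lebesgue_measure R]_(x in `[0%R, 1%R])
      \int[@lebesgue_measure R]_(y in `[0%R, 1%R]) h x y)%E.
Proof.
move=> L0 h0 gh.
have -> : (\sum_c g c) / #|{: 'I_L * 'I_L}|%:R =
    (\sum_i (\sum_j g (i, j)) / L%:R) / L%:R.
  rewrite card_prod card_ord natrM invfM -mulr_suml mulrA; congr (_ / _ / _).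
  by rewrite pair_big/=; apply: eq_bigr => -[].
apply: integral_cell1_ge => // [x|i x ix]; first exact: integral_ge0.
by apply: integral_cell1_ge => // j y jy; exact: gh.
Qed.

End GridIntegral.

(** * From points to grid cells *)

Section Discretization.
Variable R : realType.
Local Open Scope classical_set_scope.

Lemma iter_unifS k (F : seq (R * R) -> \bar R) :
  iter_unif k.+1 F = (\int[@lebesgue_measure R]_(x in `[0%R, 1%R])
    \int[@lebesgue_measure R]_(y in `[0%R, 1%R])
      iter_unif k (fun s => F ((x, y) :: s)))%E.
Proof. by []. Qed.

Lemma iter_unif_ge0 k (F : seq (R * R) -> \bar R) :
  (forall s, (0 <= F s)%E) -> (0 <= iter_unif k F)%E.
Proof.
elim: k F => [|k IH] F F0 /=; first exact: F0.
by apply: integral_ge0 => x _; apply: integral_ge0 => y _; apply: IH.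
Qed.

Variable L : nat.
Hypothesis L_gt0 : (0 < L)%N.
Local Notation C := ('I_L * 'I_L)%type.

Definition cell0 : C := (Ordinal L_gt0, Ordinal L_gt0).

(** A relation and not a map from points to cells: a point with a coordinate equal to 1 lies in no
    half-open cell. *)
Definition matches (w : seq C) (s : seq (R * R)) : Prop :=
  size w = size s /\
  forall i, (i < size s)%N -> incell (nth cell0 w i) (nth (0, 0) s i).

Lemma matches_rcons w s c p :
  matches w s -> incell c p -> matches (rcons w c) (rcons s p).
Proof.
move=> [sw ws] cp; split=> [|i]; first by rewrite !size_rcons sw.
rewrite size_rcons ltnS leq_eqVlt !nth_rcons sw => /orP[/eqP ->|i_s].
  by rewrite ltnn eqxx.
by rewrite i_s; exact: ws.
Qed.

(** Abstract stopping problem: [Q s] says that the last point of the prefix [s] is picked, [D] is a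
    favourable event on cell words, and [cl] marks the cells that later points must avoid after a
    pick. *)
Variables (cl : C -> C -> bool) (d : nat).
Hypothesis card_cl : forall c, (#|[pred c' | cl c c']| <= d)%N.
Variables (Q E : seq (R * R) -> Prop) (D : seq C -> bool) (n N1 : nat).
Hypothesis Q_late : forall s, Q s -> (N1 < size s)%N.
Hypothesis E_unpicked : forall w s, matches w s -> size s = n -> D w ->
  (forall i, (i <= n)%N -> ~ Q (take i s)) -> E s.
Hypothesis E_picked : forall w s i, matches w s -> size s = n -> D w ->
  (i < n)%N -> Q (take i.+1 s) ->
  (forall j, (i < j < n)%N -> ~~ cl (nth cell0 w i) (nth cell0 w j)) -> E s.

Local Notation delta := (d%:R / #|{: C}|%:R : R).
Local Notation bad w := ((~~ D w)%:R : R).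
Local Notation ind s := ((if `[< E s >] then 1 else 0)%:E : \bar R).

Let C_gt0 : (0 < #|{: C}|)%N. Proof. by apply/card_gt0P; exists cell0. Qed.

Let ind_ge0 s : (0 <= ind s)%E.
Proof. by case: ifP => _; rewrite lee_fin. Qed.

Let dE_step k w : (\sum_c dE k (fun t => bad (rcons w c ++ t))) / #|{: C}|%:R =
  dE k.+1 (fun t => bad (w ++ t)).
Proof.
rewrite /=; congr (_ / _); apply: eq_bigr => c _.
by apply: (eq_dE C_gt0) => t _; rewrite cat_rcons.
Qed.

Let ind_step k s p : iter_unif k (fun t => ind (s ++ p :: t)) =
  iter_unif k (fun t => ind (rcons s p ++ t)).
Proof. by congr iter_unif; apply/funext => t; rewrite cat_rcons. Qed.

(** Induction on the number of points to come: each lands in a cell close to the picked one with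
    probability at most [delta], and these losses add up with that of [D]. *)
Lemma prob_picked_ge k w s i : (size s + k)%N = n -> matches w s ->
  (i < size s)%N -> Q (take i.+1 s) ->
  (forall j, (i < j < size s)%N -> ~~ cl (nth cell0 w i) (nth cell0 w j)) ->
  ((1 - k%:R * delta - dE k (fun t => bad (w ++ t)))%:E <=
    iter_unif k (fun t => ind (s ++ t)))%E.
Proof.
elim: k w s => [|k IH] w s skn ws i_s Qs far.
  rewrite addn0 in skn; subst n; rewrite /= !cats0 lee_fin.
  case: (boolP (D w)) => Dw /=; last by rewrite mul0r subr0 subrr; case: ifP.
  by rewrite asboolT ?mul0r ?subr0//; exact: E_picked far.
set ci := nth cell0 w i.
pose g c := 1 - k%:R * delta - (cl ci c)%:R - dE k (fun t => bad (rcons w c ++ t)).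
rewrite iter_unifS; apply: le_trans (integral_incell_ge (g := g) L_gt0 _ _); last 2 first.
- by move=> x y; exact: iter_unif_ge0.
- move=> c x y cxy; rewrite ind_step /g.
  (* For a close cell the term [(cl ci c)%:R] equals 1 and makes the bound nonpositive, hence
     trivial. *)
  have [clc|clc] := boolP (cl ci c).
    apply: le_trans (iter_unif_ge0 _ _) => //=.
    have : 0 <= k%:R * delta by rewrite mulr_ge0 ?divr_ge0.
    have : 0 <= dE k (fun t => bad (rcons w c ++ t)).
      by apply: (dE_ge0 C_gt0).
    by rewrite lee_fin; lra.
  rewrite subr0; apply: IH.
  + by rewrite size_rcons; lia.
  + exact: matches_rcons.
  + by rewrite size_rcons; lia.
  + by rewrite -cats1 takel_cat.
  + have [sw _] := ws; move=> j; rewrite size_rcons ltnS => /andP[ij js].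
    rewrite !nth_rcons sw i_s; case: ltnP => [js'|sj]; first by apply: far; lia.
    by rewrite eqn_leq js sj.
rewrite -dE_step lee_fin /g !sumrB mulrBl mulrBl mulrBl !(avg_cst C_gt0) -natr1 mulrDl mul1r.
rewrite opprD addrA lerD2r lerD2l lerN2 ler_pM2r ?invr_gt0 ?ltr0n//.
rewrite -natr_sum ler_nat; apply: leq_trans (card_cl ci).
by rewrite -sum1_card [leqRHS]big_mkcond.
Qed.

(** The bound [g] depends on the new cell alone and is valid whether or not the new point is picked,
    so the case distinction happens pointwise under the integral. *)
Lemma prob_unpicked_ge k w s : (size s + k)%N = n -> matches w s ->
  (forall i, (i <= size s)%N -> ~ Q (take i s)) ->
  ((1 - (n - N1)%:R * delta - dE k (fun t => bad (w ++ t)))%:E <=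
    iter_unif k (fun t => ind (s ++ t)))%E.
Proof.
have d0 : 0 <= delta by rewrite divr_ge0.
elim: k w s => [|k IH] w s skn ws nQ.
  rewrite addn0 in skn; rewrite /= !cats0 lee_fin.
  have : 0 <= (n - N1)%:R * delta by rewrite mulr_ge0.
  case: (boolP (D w)) => Dw /=; last by case: ifP => _; lra.
  by rewrite asboolT; [lra|apply: E_unpicked Dw _ => // i; rewrite -skn; exact: nQ].
pose g c := 1 - (n - N1)%:R * delta - dE k (fun t => bad (rcons w c ++ t)).
rewrite iter_unifS; apply: le_trans (integral_incell_ge (g := g) L_gt0 _ _); last 2 first.
- by move=> x y; exact: iter_unif_ge0.
- move=> c x y cxy; rewrite ind_step /g.
  have skn' : (size (rcons s (x, y)) + k)%N = n by rewrite size_rcons; lia.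
  (* A pick occurs only after [N1] points, so at most [n - N1] points remain and [prob_picked_ge]
     gives at least the required bound. *)
  have [Qs|nQs] := pselect (Q (rcons s (x, y))).
    apply: le_trans (prob_picked_ge (i := size s) skn' (matches_rcons ws cxy) _ _ _).
    + rewrite lee_fin lerD2r lerD2l lerN2 ler_wpM2r// ler_nat.
      by have := Q_late Qs; lia.
    + by rewrite size_rcons.
    + by rewrite take_oversize// size_rcons.
    + by move=> j; rewrite size_rcons; lia.
  apply: IH => //; first exact: matches_rcons.
  move=> i; rewrite size_rcons leq_eqVlt => /orP[/eqP ->|is_].
    by rewrite take_oversize// size_rcons.
  by rewrite -cats1 takel_cat; [exact: nQ|lia].
by rewrite -dE_step lee_fin /g sumrB mulrBl (avg_cst C_gt0).
Qed.

Lemma prob_unif_ge :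
  ((1 - (n - N1)%:R * delta - dE n (fun w => bad w))%:E <= prob_unif n E)%E.
Proof.
apply: (@prob_unpicked_ge n [::] [::]) => //.
by move=> i _ /Q_late.
Qed.

End Discretization.

(** * Geometry of the torus *)

Section Coarsening.
Variables (L K b : nat).
Hypothesis L_eq : L = (K * b)%N.
Hypothesis b_gt0 : (0 < b)%N.

Lemma coarse_subproof (i : 'I_L) : (i %/ b < K)%N.
Proof. by rewrite ltn_divLR// -L_eq. Qed.

Definition coarse1 (i : 'I_L) : 'I_K := Ordinal (coarse_subproof i).

Definition coarse (c : 'I_L * 'I_L) := (coarse1 c.1, coarse1 c.2).

Lemma card_coarse1 j : #|[set i | coarse1 i == j]| = b.
Proof.
have lt_L (t : 'I_b) : (j * b + t < L)%N.
  by rewrite L_eq; have := ltn_ord t; have := ltn_ord j; nia.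
have <- : #|[set Ordinal (lt_L t) | t in 'I_b]| = b.
  rewrite card_imset ?card_ord// => t u /(congr1 val)/= /addnI tu.
  exact: val_inj.
congr #|pred_of_set _|; apply/setP => i; rewrite inE; apply/eqP/imsetP.
  move=> ij; exists (Ordinal (ltn_pmod i b_gt0)) => //.
  by apply: val_inj; rewrite /= -ij/= -divn_eq.
move=> [t _ ->]; apply: val_inj.
by rewrite /= divnMDl// divn_small// addn0.
Qed.

Lemma card_coarse g : #|[set c | coarse c == g]| = (b ^ 2)%N.
Proof.
case: g => g1 g2; rewrite -mulnn -{1}(card_coarse1 g1) -[X in (_ * X)%N](card_coarse1 g2).
rewrite -cardsX; congr #|pred_of_set _|.
by apply/setP => c; rewrite !inE xpair_eqE.
Qed.

End Coarsening.

Section BlockCenter.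
Variables (L K : nat).
Hypothesis L_eq : L = (K * 3)%N.

Lemma center_subproof (j : 'I_K) : (j * 3 + 1 < L)%N.
Proof. by rewrite L_eq; have := ltn_ord j; lia. Qed.

Definition center1 (j : 'I_K) : 'I_L := Ordinal (center_subproof j).

Definition center (g : 'I_K * 'I_K) := (center1 g.1, center1 g.2).

Lemma centerK : cancel center (coarse L_eq (isT : 0 < 3)%N).
Proof.
by move=> [g1 g2]; congr (_, _); apply: val_inj; rewrite /= divnMDl// addn0.
Qed.

End BlockCenter.

(* Two cells in columns [i] and [j] are at circular distance at least [1 / L]. *)
Definition far1 (L i j : nat) : bool :=
  ((i.+2 <= j) && (j.+2 <= L + i) || (j.+2 <= i) && (i.+2 <= L + j))%N.

(** The centre column is the middle one of three, so a column of another block is at least two steps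
    away in both directions around the circle. *)
Lemma far1_center L K (L_eq : L = (K * 3)%N) (g : 'I_K) (j : 'I_L) :
  coarse1 L_eq isT j != g -> far1 L (center1 L_eq g) j.
Proof.
rewrite -val_eqE /= /far1 => jg.
have := ltn_ord j; have := ltn_ord g; have := divn_eq j 3.
by have := ltn_pmod j (isT : 0 < 3)%N; lia.
Qed.

(** The near columns are [i] and its two neighbours; listing 0 and [L.-1] as well covers the
    wrap-around uniformly in [i]. *)
Lemma card_near1 L (i : 'I_L) : (#|[pred j : 'I_L | ~~ far1 L i j]| <= 5)%N.
Proof.
pose s := [:: i.-1; val i; i.+1; 0%N; L.-1].
rewrite cardE -(size_map val) -[5%N]/(size s); apply: uniq_leq_size.
  by rewrite map_inj_uniq ?enum_uniq//; exact: val_inj.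
move=> _ /mapP[j + ->]; rewrite mem_enum inE /far1 /s !inE => nf.
by have := ltn_ord i; have := ltn_ord j; move: nf => /=; lia.
Qed.

Section Far.
Variable L : nat.
Local Notation C := ('I_L * 'I_L)%type.

Definition far (c c' : C) := far1 L c.1 c'.1 || far1 L c.2 c'.2.

Lemma card_near (c : C) : (#|[pred c' | ~~ far c c']| <= 25)%N.
Proof.
rewrite (_ : #|_| = #|[predX [pred j : 'I_L | ~~ far1 L c.1 j] &
    [pred j : 'I_L | ~~ far1 L c.2 j]]|).
  by rewrite cardX (leq_mul (card_near1 _) (card_near1 _)).
by apply: eq_card => -[j1 j2]; rewrite !inE /far negb_or.
Qed.

Lemma far_center K (L_eq : L = (K * 3)%N) (g : 'I_K * 'I_K) (c : C) :
  coarse L_eq isT c != g -> far (center L_eq g) c.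
Proof.
case: g => g1 g2; rewrite /coarse xpair_eqE negb_and /far.
by case/orP => ?; apply/orP; [left|right]; exact: far1_center.
Qed.

End Far.

(** * Torus distance and bounds on the areas of Voronoi cells *)

Section Torus.
Variable R : realType.
Implicit Types (x y z r : R) (p q : R * R).

Lemma dT1C x y : dT1 x y = dT1 y x.
Proof. by rewrite /dT1 distrC. Qed.

Lemma dTC p q : dT p q = dT q p.
Proof. by rewrite /dT dT1C (dT1C p.2). Qed.

Lemma dT1_triangle x y z : 0 <= x <= 1 -> 0 <= y <= 1 -> 0 <= z <= 1 ->
  dT1 x z <= dT1 x y + dT1 y z.
Proof.
move=> /andP[x0 x1] /andP[y0 y1] /andP[z0 z1]; rewrite /dT1 !minElt.
case: (ger0P (x - z)); case: (ger0P (x - y)); case: (ger0P (y - z)) => ? ? ?;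
  do 3![case: ltP => ?]; lra.
Qed.

Lemma dT_ge p q r : 0 <= r -> r <= dT1 p.1 q.1 \/ r <= dT1 p.2 q.2 -> r <= dT p q.
Proof.
move=> r0 h; rewrite -(ger0_norm r0) -sqrtr_sqr /dT ler_wsqrtr//.
have := sqr_ge0 (dT1 p.1 q.1); have := sqr_ge0 (dT1 p.2 q.2).
by case: h => h; rewrite !expr2; nra.
Qed.

Lemma dT_le p q r : 0 <= r -> 0 <= dT1 p.1 q.1 <= r -> 0 <= dT1 p.2 q.2 <= r ->
  dT p q <= 2 * r.
Proof.
move=> r0 /andP[a0 ar] /andP[b0 br]; rewrite -[2 * r]ger0_norm ?mulr_ge0//.
by rewrite -sqrtr_sqr ler_wsqrtr// !expr2; nra.
Qed.

Lemma dT1_ge0 x y : 0 <= x <= 1 -> 0 <= y <= 1 -> 0 <= dT1 x y.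
Proof.
move=> /andP[x0 x1] /andP[y0 y1]; rewrite /dT1 le_min normr_ge0/=.
by rewrite subr_ge0 ler_norml; apply/andP; split; lra.
Qed.

Lemma dT1_le_dist x y : dT1 x y <= `|x - y|.
Proof. by rewrite /dT1 ge_min lexx. Qed.

Lemma dT1_far L i j x y : (0 < L)%N -> far1 L i j ->
  cell1 L i x -> cell1 L j y -> L%:R^-1 <= dT1 x y.
Proof.
move=> L0; have LR : 0 < L%:R :> R by rewrite ltr0n.
wlog : i j x y / (i.+2 <= j)%N && (j.+2 <= L + i)%N.
  move=> h f ci cj; have [f'|f'] := orP f; first exact: h ci cj.
  by rewrite dT1C; apply: h cj ci => //; rewrite /far1 f'.
rewrite -!(ler_nat R) natrD -!natr1 => /andP[ij ji] _.
rewrite /cell1 !ler_pdivrMr// !ltr_pdivlMr// -!natr1 => /andP[ix xi] /andP[jy yj].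
have xy : L%:R^-1 <= y - x by rewrite -[leLHS]mul1r ler_pdivrMr//; lra.
have yx : y - x <= 1 - L%:R^-1.
  rewrite lerBrDr -lerBrDl -[leLHS]mul1r ler_pdivrMr//; lra.
have Li : 0 < L%:R^-1 :> R by rewrite invr_gt0.
rewrite /dT1 le_min distrC ger0_norm; last by lra.
by rewrite xy/=; lra.
Qed.

Lemma dT_far L (c c' : 'I_L * 'I_L) p q : (0 < L)%N -> far c c' ->
  incell c p -> incell c' q -> L%:R^-1 <= dT p q.
Proof.
move=> L0 /orP[f|f] [c1 c2] [c1' c2']; apply: dT_ge; rewrite ?invr_ge0//.
  by left; exact: dT1_far f c1 c1'.
by right; exact: dT1_far f c2 c2'.
Qed.

Lemma incell_unit L (c : 'I_L * 'I_L) p : incell c p -> unit_square p.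
Proof.
have L0 : (0 < L)%N by case: c => [[i]]; case: L.
have LR : 0 < L%:R :> R by rewrite ltr0n.
have cell1_unit (i : 'I_L) x : cell1 L i x -> 0 <= x <= 1.
  move=> /andP[ix xi]; apply/andP; split; first by apply: le_trans ix; rewrite divr_ge0.
  by apply/ltW; apply: (lt_le_trans xi); rewrite ler_pdivrMr// mul1r ler_nat.
by move=> [/cell1_unit ? /cell1_unit ?].
Qed.

Local Open Scope classical_set_scope.

Lemma area_rectangle (a b c d : R) : a <= b -> c <= d ->
  area (`[a, b] `*` `[c, d]) = ((b - a) * (d - c))%:E.
Proof.
move=> ab cd; rewrite /area product_measure1E; [|exact: measurable_itv..].
have itv_len (u v : R) : u <= v -> @lebesgue_measure R `[u, v] = (v - u)%:E.
  rewrite le_eqVlt => /orP[/eqP->|uv].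
    by rewrite lebesgue_measure_itv/= ltxx subrr.
  by rewrite lebesgue_measure_itv/= lte_fin uv EFinB.
by rewrite [X in (X * _)%E](itv_len a b ab) [X in (_ * X)%E](itv_len c d cd) EFinM.
Qed.

(** The interval extends from [x] towards the farther end of [[0, 1]], so with [r <= 1/2] it never
    leaves the unit interval. *)
Lemma near_interval x r : 0 <= x <= 1 -> 0 <= r <= 2^-1 ->
  exists lo, forall y, lo <= y <= lo + r -> 0 <= y <= 1 /\ dT1 y x <= r.
Proof.
move=> /andP[x0 x1] /andP[r0 r1].
exists (if x <= 2^-1 then x else x - r) => y.
case: ifPn; rewrite -?ltNge => x2 /andP[ly yl]; split; try lra.
  apply: le_trans (dT1_le_dist _ _) _; rewrite ler_norml; lra.
apply: le_trans (dT1_le_dist _ _) _; rewrite ler_norml; lra.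
Qed.

(** The cell contains a square of side [r] with corner at the site: its points are within [2 * r] of
    the site and, by the triangle inequality in one coordinate, at least [2 * r] from every other
    site. *)
Lemma cell_area_ge (s : seq (R * R)) i r : 0 <= r <= 2^-1 ->
  (forall j, (j < size s)%N -> unit_square (pt s j)) -> (i < size s)%N ->
  (forall j, (j < size s)%N -> j != i -> 6 * r <= dT (pt s j) (pt s i)) ->
  ((r ^+ 2)%:E <= cell_area s i)%E.
Proof.
move=> r01 us is_ sep; have /andP[r0 r1] := r01.
have [u1 u2] := us _ is_.
have [a ha] := near_interval u1 r01; have [b hb] := near_interval u2 r01.
have <- : area (`[a, a + r] `*` `[b, b + r]) = (r ^+ 2)%:E.
  by rewrite area_rectangle ?lerDl//; congr EFin; ring.
apply: area_le => q [/=]; rewrite !in_itv/= => /ha[q1 d1] /hb[q2 d2].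
split=> // j js; have [->//|ji] := eqVneq j i.
have uj := us _ js.
apply: (@le_trans _ _ (2 * r)).
  by apply: dT_le => //; apply/andP; split=> //; exact: dT1_ge0.
(* If both coordinates differed by less than [3 * r], the distance would be below [6 * r]. *)
have : 3 * r <= dT1 (pt s j).1 (pt s i).1 \/ 3 * r <= dT1 (pt s j).2 (pt s i).2.
  case: (lerP (3 * r)) => [h|h1]; first by left.
  case: (lerP (3 * r)) => [h|h2]; first by right.
  exfalso; have := sep _ js ji; apply/negP; rewrite -ltNge.
  have [uj1 uj2] := uj.
  have e1 := dT1_ge0 uj1 u1; have e2 := dT1_ge0 uj2 u2.
  have r0' : 0 < r by lra.
  rewrite /dT -(@ger0_norm _ (6 * r)) ?mulr_ge0// -sqrtr_sqr ltr_sqrt.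
    by rewrite !expr2; nra.
  by rewrite exprn_gt0// mulr_gt0.
move=> h; apply: dT_ge; first by rewrite mulr_ge0.
have [uj1 uj2] := uj.
case: h => h; [left|right].
  by have := dT1_triangle uj1 q1 u1; rewrite (dT1C _ q.1); lra.
by have := dT1_triangle uj2 q2 u2; rewrite (dT1C _ q.2); lra.
Qed.

(** A point of the cell is at distance at most [r] from some site, hence from its own. Each
    coordinate then lies in one of three translates, by 0, -1 and 1, of an interval of length
    [2 * r]. *)
Lemma cell_area_le (s : seq (R * R)) i r : 0 <= r ->
  unit_square (pt s i) ->
  (forall q, unit_square q -> exists2 j, (j < size s)%N & dT q (pt s j) <= r) ->
  (cell_area s i <= ((6 * r) ^+ 2)%:E)%E.
Proof.
move=> r0 [p1 p2] cover.
pose I a : set R := `[a - r, a + r].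
pose J a := I a `|` (I (a - 1) `|` I (a + 1)).
have I_len a : @lebesgue_measure R (I a) = (2 * r)%:E.
  rewrite lebesgue_measure_itv/= lte_fin; case: ltP => [_|h].
    by rewrite -EFinB; congr EFin; ring.
  by have -> : r = 0; [lra|rewrite mulr0].
have mJ a : measurable (J a : set (measurableTypeR R)).
  by apply: measurableU; [|apply: measurableU]; exact: measurable_itv.
pose mu : {measure set (measurableTypeR R) -> \bar R} := @lebesgue_measure R.
have mu_len a : mu (I a) = (2 * r)%:E by exact: I_len.
have J_len a : (mu (J a) <= (6 * r)%:E)%E.
  have s1 : (mu (J a) <= mu (I a) + (mu (I (a - 1)%R) + mu (I (a + 1)%R)))%E.
    apply: le_trans (measureU2 _ _ _) _; [exact: measurable_itv|
      by apply: measurableU; exact: measurable_itv|].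
    by apply: leeD2l; apply: measureU2; exact: measurable_itv.
  by apply: le_trans s1 _; rewrite !mu_len -!EFinD lee_fin; lra.
have JP x a : 0 <= a <= 1 -> 0 <= x <= 1 -> dT1 x a <= r -> J a x.
  move=> /andP[a0 a1] /andP[x0 x1]; rewrite /dT1 ge_min => /orP[h|h].
    left; rewrite /I /= in_itv/=; move: h; rewrite ler_norml => /andP[? ?].
    by apply/andP; split; lra.
  by right; case: (ger0P (x - a)) h => xa h;
    [right|left]; rewrite /I /= in_itv/=; apply/andP; split; lra.
apply: (@le_trans _ _ (area (J (pt s i).1 `*` J (pt s i).2))).
  apply: area_le => q [uq /= hq]; have [j js qj] := cover _ uq.
  have qi := le_trans (hq _ js) qj; have [u1 u2] := uq.
  split; apply: JP => //; apply: le_trans qi.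
    by apply: dT_ge; [exact: dT1_ge0|left].
  by apply: dT_ge; [exact: dT1_ge0|right].
rewrite /area product_measure1E// expr2 EFinM.
by apply: lee_pmul => //; exact: J_len.
Qed.

Lemma cell1_coarse L M b (LM : L = (M * b)%N) (b0 : (0 < b)%N) (i : 'I_L) x :
  cell1 L i x -> cell1 M (coarse1 LM b0 i) x.
Proof.
have L0 : (0 < L)%N by case: i => i; case: L LM.
have M0 : (0 < M)%N by move: L0; rewrite LM; case: M LM.
rewrite /cell1 !ler_pdivrMr ?ltr0n// !ltr_pdivlMr ?ltr0n// => /andP[ix xi].
have bR : 0 < b%:R :> R by rewrite ltr0n.
have lo : (i %/ b * b <= i)%N by exact: leq_divM.
have hi : (i.+1 <= (i %/ b).+1 * b)%N by exact: ltn_ceil.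
rewrite -(ler_nat R) natrM in lo; rewrite -(ler_nat R) natrM in hi.
have LR : L%:R = M%:R * b%:R :> R by rewrite [in LHS]LM natrM.
move: ix xi; rewrite LR mulrA => ix xi.
rewrite /= -(ler_pM2r bR) -[X in _ && X](ltr_pM2r bR); apply/andP; split.
  exact: le_trans ix.
exact: lt_le_trans xi _.
Qed.

(** Closed on the right, and with the index capped at [M.-1], so that [x = 1] is covered too. *)
Lemma unit_grid M x : (0 < M)%N -> 0 <= x <= 1 ->
  exists i : 'I_M, i%:R / M%:R <= x <= i.+1%:R / M%:R.
Proof.
move=> M0 /andP[x0 x1]; have MR : 0 < M%:R :> R by rewrite ltr0n.
pose k := minn (Num.truncn (x * M%:R)) M.-1.
have kM : (k < M)%N by rewrite /k; lia.
exists (Ordinal kM) => /=; rewrite ler_pdivrMr// ler_pdivlMr//.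
have xM0 : 0 <= x * M%:R by rewrite mulr_ge0.
have /andP[t1 t2] := truncn_itv xM0.
apply/andP; split; first by apply: le_trans t1; rewrite ler_nat geq_minl.
rewrite /k /minn; case: ifP => _; first exact: ltW.
by rewrite prednK// -[leRHS]mul1r ler_pM2r.
Qed.

(** Every point shares a coarse cell with some site, which is within [1 / M] in each coordinate; so
    [cell_area_le] applies with [r = 2 / M]. *)
Lemma cell_area_le_coarse L M b (LM : L = (M * b)%N) (b0 : (0 < b)%N) (L0 : (0 < L)%N)
    (w : seq ('I_L * 'I_L)) (s : seq (R * R)) i :
  matches L0 w s -> (forall g, g \in map (coarse LM b0) w) -> (i < size s)%N ->
  (cell_area s i <= ((12 / M%:R) ^+ 2)%:E)%E.
Proof.
move=> [sw ws] cov is_.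
have M0 : (0 < M)%N by have := L0; rewrite {1}LM muln_gt0 => /andP[].
have MR : 0 < M%:R :> R by rewrite ltr0n.
have -> : 12 / M%:R = 6 * (2 * M%:R^-1) :> R by rewrite mulrA -natrM.
apply: cell_area_le => //.
  exact: incell_unit (ws _ is_).
move=> q uq; have [u1 u2] := uq.
have [g1 /andP[a1 b1]] := unit_grid M0 u1; have [g2 /andP[a2 b2]] := unit_grid M0 u2.
have /mapP[c cw cg] := cov (g1, g2).
have js : (index c w < size s)%N by rewrite -sw index_mem.
exists (index c w) => //.
have cin := ws _ js; rewrite nth_index// in cin.
have [v1 v2] := incell_unit cin.
case: cin => /(cell1_coarse LM b0) /andP[c1 d1] /(cell1_coarse LM b0) /andP[c2 d2].
case: cg => e1 e2; move: c1 d1 c2 d2; rewrite -e1 -e2 /=.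
rewrite -natr1 mulrDl mul1r in b1; rewrite -natr1 mulrDl mul1r in b2.
rewrite -(natr1 g1) -(natr1 g2) !(mulrDl _%:R) !mul1r => c1 d1 c2 d2.
apply: dT_le; first by rewrite invr_ge0.
  rewrite dT1_ge0//=; apply: le_trans (dT1_le_dist _ _) _.
  by rewrite ler_norml; apply/andP; split; rewrite /pt; lra.
rewrite dT1_ge0//=; apply: le_trans (dT1_le_dist _ _) _.
by rewrite ler_norml; apply/andP; split; rewrite /pt; lra.
Qed.

End Torus.

(** * Success probability of the stopping rule *)

Lemma no_candPn (C B : finType) (blk : C -> B) (cen : B -> C) c0 A w :
  ~~ no_cand blk cen A w ->
  exists i, [/\ (i < size w)%N, nth c0 w i = cen (blk (nth c0 w i)) &
    blk (nth c0 w i) \notin hit blk A (take i w)].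
Proof.
elim: w A => //= c w IH A; rewrite negb_and negbK => /orP[/andP[/eqP cc cA]|].
  by exists 0%N.
by move=> /IH[i [iw ci hi]]; exists i.+1.
Qed.

Section Picking.
Variable R : realType.
Implicit Types (s : seq (R * R)).

Lemma candidate_take n (f rad : R) s i j : (j <= i)%N ->
  candidate n f rad (take i s) j <-> candidate n f rad s j.
Proof.
move=> ji; rewrite /candidate /pt; split=> -[j0 [jn [fj h]]]; do !split=> //;
  move=> k k0 kj; have := h k k0 kj; rewrite !nth_take//; lia.
Qed.

(** The rule does not look ahead, so a pick can be recognised on the prefix ending there. *)
Lemma picks_take n (f rad : R) s i :
  picks n f rad (take i s) i <-> picks n f rad s i.
Proof.
rewrite /picks candidate_take//.
split=> -[ci h]; split=> // j ji; have := h j ji; rewrite candidate_take//; exact: ltnW.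
Qed.

Lemma candidate_picks n (f rad : R) s i : candidate n f rad s i ->
  exists2 j, (j <= i)%N & picks n f rad s j.
Proof.
move=> ci; have ex : exists j, `[< candidate n f rad s j >] by exists i; apply/asboolP.
exists (ex_minn ex); first by case: ex_minnP => j _; apply; apply/asboolP.
case: ex_minnP => j /asboolP cj minj; split=> // k kj /asboolP /minj.
by rewrite leqNgt kj.
Qed.

Section GridBound.
Variables (M n N1 : nat) (f alpha beta : R).
Hypothesis M_gt0 : (0 < M)%N.
Hypothesis N1_le : (N1 <= n)%N.
Hypothesis f_late : forall i : nat, n%:R - f < i%:R <-> (N1 < i)%N.

(** Per side there are [M] coarse cells, [K] blocks and [L] cells. For the eventual [M] a block
    receives at most [ln n / 8] points on average, so it stays empty with probability at least
    [n ^ (-1/4)]. *)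
Let K := (M * 8)%N.
Let L := (K * 3)%N.
Let rad : R := (2 * L%:R)^-1.
Let L_gt0 : (0 < L)%N. Proof. by rewrite /L /K; lia. Qed.
Let LK : L = (K * 3)%N. Proof. by []. Qed.
Let LM : L = (M * 24)%N. Proof. by rewrite /L /K -mulnA. Qed.
Let C : finType := ('I_L * 'I_L)%type.
Let c0 : C := cell0 L_gt0.
Let blk := coarse LK (isT : (0 < 3)%N).
Let big := coarse LM (isT : (0 < 24)%N).
Let cen := center LK.

Hypothesis alpha_le : alpha * (ln n%:R / n%:R) <= (rad / 6) ^+ 2.
Hypothesis beta_ge : (12 / M%:R) ^+ 2 <= beta * (ln n%:R / n%:R).

Let all_hit (w : seq C) := empties (hit big finset.set0 w) == 0%N.
Let has_cand (w : seq C) :=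
  ~~ no_cand blk cen (hit blk finset.set0 (take N1 w)) (drop N1 w).
Let D w := all_hit w && has_cand w.
Let Q s := picks n f rad s (size s).

Let LR : 0 < L%:R :> R. Proof. by rewrite ltr0n. Qed.

Let rad_lt : rad < L%:R^-1.
Proof. by rewrite /rad ltf_pV2 ?posrE ?mulr_gt0//; have := LR; lra. Qed.

Let dT_far_lt (c c' : C) (p q : R * R) : far c c' -> incell c p -> incell c' q ->
  (rad < dT q p :> R).
Proof.
by move=> f1 cp cq; rewrite dTC; apply: lt_le_trans rad_lt _; exact: dT_far f1 cp cq.
Qed.

(** Contradiction: a centre hit in a fresh block after round [N1] is a candidate, and the first
    candidate is picked. *)
Let unpicked w s : matches L_gt0 w s -> size s = n -> D w ->
  (forall i, (i <= n)%N -> ~ Q (take i s)) -> good_event n f rad alpha beta s.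
Proof.
move=> [sw ws] sn /andP[_ /(no_candPn c0)[i [iw ci hi]]] nQ; exfalso.
rewrite size_drop sw sn in iw.
move: ci hi; rewrite nth_drop -hit_cat -takeD mem_hit inE/= => ci hi.
set k := (N1 + i)%N in ci hi; have kn : (k < n)%N by rewrite /k; lia.
(* Rounds are counted from 1 and word positions from 0. *)
have cand : candidate n f rad s k.+1.
  do !split=> //; first by apply/f_late; rewrite /k; lia.
  move=> j j0 jk; have jn : (j.-1 < size s)%N by rewrite sn; lia.
  apply: (@dT_far_lt (nth c0 w k) (nth c0 w j.-1)); last 2 first.
  - by apply: ws; rewrite sn.
  - exact: ws.
  rewrite ci; apply: far_center; apply: contraNneq hi => <-.
  apply: map_f; have <- : nth c0 (take k w) j.-1 = nth c0 w j.-1.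
    by rewrite nth_take//; lia.
  by rewrite mem_nth// size_take sw sn kn; lia.
have [j jk pj] := candidate_picks cand.
have jn : (j <= n)%N by lia.
apply: (nQ _ jn); rewrite /Q size_takel ?sn//.
by apply/picks_take.
Qed.

(** Earlier points are farther than [rad] by the stopping rule, later ones by [far_i]; hence
    [cell_area_ge] with [r = rad / 6]. The upper bound comes from [all_hit]. *)
Let picked w s i : matches L_gt0 w s -> size s = n -> D w ->
  (i < n)%N -> Q (take i.+1 s) ->
  (forall j, (i < j < n)%N -> far (nth c0 w i) (nth c0 w j)) ->
  good_event n f rad alpha beta s.
Proof.
move=> mws sn /andP[/eqP hits _] i_n; have [sw ws] := mws.
rewrite /Q size_takel ?sn// => /picks_take pick far_i.
split; last first.
  move=> j jn; apply: le_trans (_ : ((12 / M%:R) ^+ 2)%:E <= _)%E; last first.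
    by rewrite lee_fin.
  apply: (@cell_area_le_coarse _ _ _ _ LM isT L_gt0 w) => //; last by rewrite sn.
  move=> g; have : g \notin ~: hit big finset.set0 w.
    by rewrite (cards0_eq hits) inE.
  by rewrite inE negbK mem_hit inE.
exists i.+1; split=> //=; apply: (@le_trans _ _ ((rad / 6) ^+ 2)%:E).
  by rewrite lee_fin.
have rad0 : 0 < rad by rewrite invr_gt0 mulr_gt0.
have L1 : 1 <= L%:R :> R by rewrite ler1n.
apply: cell_area_ge.
- apply/andP; split; first by lra.
  have : L%:R^-1 <= 1 :> R by rewrite invf_le1.
  by have := rad_lt; lra.
- by move=> j js; exact: incell_unit (ws _ js).
- by rewrite sn.
move=> j js ji; rewrite mulrC divfK//.
have [ij|ji'] := ltnP i j.
  apply/ltW; apply: dT_far_lt (ws _ _) (ws _ js); last by rewrite sn.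
  by apply: far_i; rewrite ij -sn.
have [[_ [_ [_ h]]] _] := pick.
by apply/ltW; apply: (h j.+1) => //; rewrite ltnS ltn_neqAle ji.
Qed.

Let m : R := (K ^ 2)%:R.
Let mu : R := m * (1 - m^-1) ^+ N1.

Hypothesis late_le : (n - N1)%:R <= mu / 4.

Lemma good_event_prob_ge :
  ((1 - (n - N1)%:R * (25 / (L ^ 2)%:R) -
    ((M ^ 2)%:R * (1 - (M ^ 2)%:R^-1) ^+ n +
     (4 / mu + (1 - mu / 4 / (L ^ 2)%:R) ^+ (n - N1))))%:E <=
   prob_unif n (good_event n f rad alpha beta))%E.
Proof.
have cardC k : #|{: 'I_k * 'I_k}| = (k ^ 2)%N by rewrite card_prod card_ord mulnn.
have C0 : (0 < #|C|)%N by apply/card_gt0P; exists c0.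
have Q_late s : Q s -> (N1 < size s)%N by move=> [[_ [_ [/f_late]]]].
apply: le_trans (@prob_unif_ge R L L_gt0 (fun c c' => ~~ far c c') 25 (@card_near L)
  Q _ D n N1 Q_late unpicked _); last first.
  move=> w s i mws sn Dw i_n Qs cl; apply: picked mws sn Dw i_n Qs _ => j jn.
  by have := cl j jn; rewrite negbK.
rewrite lee_fin cardC -!addrA lerD2l lerD2l lerN2.
apply: (@le_trans _ _ (dE n (fun w : seq C => (~~ all_hit w)%:R + (~~ has_cand w)%:R))).
  apply: le_dE => // w _; rewrite /D negb_and -natrD ler_nat.
  by case: all_hit; case: has_cand.
have first_moment := @dE_some_empty R C C0 _ big (24 ^ 2)%N isT (card_coarse LM isT) n.
have second_moment := @dE_no_cand_late R C C0 _ blk (3 ^ 2)%N isT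
  (card_coarse LK isT) cen (centerK LK) N1 (n - N1).
rewrite subnKC// !cardC in first_moment second_moment.
rewrite dED; apply: lerD; first exact: first_moment.
apply: le_trans (second_moment _ late_le); last first.
  by rewrite ler_nat /K expnMn; have := M_gt0; nia.
by apply: le_dE => // w _; rewrite /has_cand negbK.
Qed.

End GridBound.
End Picking.

(** * Asymptotic estimates *)

Section Asymptotics.
Variable R : realType.

Lemma expr_1B_le_expR (t : R) k : 0 <= t <= 1 -> (1 - t) ^+ k <= expR (- (k%:R * t)).
Proof.
move=> /andP[t0 t1]; rewrite -mulrN mulrC expRM_natr.
by rewrite lerXn2r ?nnegrE ?expR_ge0 ?subr_ge0//; exact: expR_ge1Dx.
Qed.

(** [exp (-2 / m) <= m / (m + 2) <= 1 - 1 / m], the last step being equivalent to [m >= 2]. *)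
Lemma expR_le_expr_1B (m : R) k : 2 <= m -> expR (- (k%:R * (2 / m))) <= (1 - m^-1) ^+ k.
Proof.
move=> m2; have m0 : 0 < m by lra.
rewrite -mulrN mulrC expRM_natr lerXn2r ?nnegrE ?expR_ge0//.
  by rewrite subr_ge0 invf_le1//; lra.
rewrite expRN; apply: (@le_trans _ _ (1 + 2 / m)^-1).
  rewrite lef_pV2 ?posrE ?expR_gt0 ?expR_ge1Dx//.
  by rewrite addr_gt0// divr_gt0.
have -> : (1 + 2 / m)^-1 = m / (m + 2) by field; lra.
have -> : 1 - m^-1 = (m - 1) / m by field; lra.
rewrite ler_pdivrMr; last lra.
rewrite mulrAC ler_pdivlMr//; nra.
Qed.

(** [x] stands for the number of coarse cells, so there are [64 * x] blocks and [576 * x] cells;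
    [mu] is the mean number of blocks empty after [N1] points and [t] the target error. *)
Variables (n N1 : nat) (l y x s mu t : R).
Hypothesis l_eq : l = ln n%:R.
(* [y] is the 16th root of [n]; it makes all the powers of [n] below polynomial. *)
Hypothesis y_eq : y = expR (l / 16).
Hypothesis s_sqrt : s = Num.sqrt n%:R.
Hypothesis mu_eq : mu = (64 * x) * (1 - (64 * x)^-1) ^+ N1.
Hypothesis t_eq : t = l ^+ 2 / s.
Hypothesis l_ge : 240 <= l.
Hypothesis x_le : x * (2 * l) <= n%:R.
Hypothesis x_ge : n%:R <= 8 * l * x.
Hypothesis x_ge1 : 1 <= x.
Hypothesis N1_le : (N1 <= n)%N.
Hypothesis late_ge : s * l <= (n - N1)%:R.
Hypothesis late_le1 : (n - N1)%:R <= s * l + 1.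

(* [lra] does not pick up section hypotheses on its own. *)
Ltac lra' := move: l_ge; lra.
Ltac nra' := move: l_ge; nra.

(** The threshold 240 is 16 times 15, so that [1 + l / 16] is at least 16. *)
Lemma root16_ge : 16 <= y.
Proof. by have := expR_ge1Dx (l / 16); rewrite -y_eq; lra'. Qed.

Lemma ln_le_root16 : l <= 16 * y.
Proof. by have := expR_ge1Dx (l / 16); rewrite -y_eq; lra. Qed.

Lemma large_n_gt0 : 0 < n%:R :> R.
Proof.
by rewrite ltr0n lt0n; apply: contraPneq l_ge => n0; rewrite l_eq n0 ln0//; lra'.
Qed.

Lemma root16_exp : n%:R = y ^+ 16.
Proof. by rewrite y_eq -expRM_natr divfK// l_eq lnK ?posrE ?large_n_gt0. Qed.

Lemma sqrt_root16 : s = y ^+ 8.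
Proof.
rewrite s_sqrt root16_exp; have -> : y ^+ 16 = (y ^+ 8) ^+ 2 by rewrite -exprM.
rewrite sqrtr_sqr ger0_norm//.
by rewrite exprn_ge0 ?y_eq ?expR_ge0.
Qed.

Let n_inv : expR (- l) = n%:R^-1.
Proof. by rewrite expRN l_eq lnK ?posrE ?large_n_gt0. Qed.

Let y4_inv : expR (- (l / 4)) = (y ^+ 4)^-1.
Proof. by rewrite expRN y_eq -expRM_natr; congr (expR _)^-1; field. Qed.

Let y0 : 0 < y. Proof. by rewrite y_eq expR_gt0. Qed.
Let l0 : 0 < l. Proof. by lra'. Qed.
Let x0 : 0 < x. Proof. exact: lt_le_trans x_ge1. Qed.

Let l2_le : l ^+ 2 <= y ^+ 4.
Proof.
have h : l <= y ^+ 2 by rewrite expr2; have := ln_le_root16; have := root16_ge; nra'.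
by rewrite (exprM y 2 2) lerXn2r// ?nnegrE ?exprn_ge0 ?ltW.
Qed.

(** From [N1 <= n <= 8 * l * x] the exponent [2 * N1 / (64 * x)] is at most [l / 4]. *)
Let q_ge : (y ^+ 4)^-1 <= (1 - (64 * x)^-1) ^+ N1.
Proof.
apply: le_trans (expR_le_expr_1B _ _); last by (move: x_ge1; lra').
rewrite -y4_inv ler_expR lerN2.
apply: (@le_trans _ _ (n%:R * (2 / (64 * x)))).
  by rewrite ler_wpM2r ?ler_nat// divr_ge0//; (move: x_ge1; lra').
rewrite mulrA ler_pdivrMr; last by (move: x_ge1; lra').
by have := x_ge; (move: x_ge1; lra').
Qed.

Let xy_ge : y ^+ 16 / (8 * l) <= x.
Proof. by rewrite ler_pdivrMr -?root16_exp; have := x_ge; move: x_ge1; lra'. Qed.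

Let mu_ge : 8 * y ^+ 12 / l <= mu.
Proof.
rewrite mu_eq; have -> : 8 * y ^+ 12 / l = 64 * (y ^+ 16 / (8 * l)) * (y ^+ 4)^-1.
  by field; rewrite !gt_eqF.
apply: ler_pM; rewrite ?invr_ge0 ?exprn_ge0 ?(ltW y0)//.
- by rewrite mulr_ge0// divr_ge0 ?exprn_ge0 ?(ltW y0)//; (move: x_ge1; lra').
- by rewrite ler_pM2l.
Qed.

Let late_le2 : (n - N1)%:R <= 2 * y ^+ 8 * l.
Proof.
have : 1 <= y ^+ 8 by rewrite exprn_ege1//; have := root16_ge; (move: x_ge1; lra').
by have := late_le1; rewrite sqrt_root16; have := l_ge; nra'.
Qed.

Lemma late_le_mu : (n - N1)%:R <= mu / 4.
Proof.
apply: le_trans late_le2 _.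
rewrite ler_pdivlMr//; apply: le_trans mu_ge; rewrite ler_pdivlMr//.
have -> : y ^+ 12 = y ^+ 8 * y ^+ 4 by rewrite -exprD.
have : 0 < y ^+ 8 by rewrite exprn_gt0.
by have := l2_le; rewrite expr2; nra'.
Qed.

Let s0 : 0 < s. Proof. by rewrite sqrt_root16 exprn_gt0. Qed.

Let n_inv_le : n%:R^-1 <= t.
Proof.
rewrite t_eq ler_pdivlMr// mulrC ler_pdivrMr ?large_n_gt0// root16_exp sqrt_root16.
have -> : y ^+ 16 = y ^+ 8 * y ^+ 8 by rewrite -exprD.
have y8 : 1 <= y ^+ 8 by rewrite exprn_ege1//; have := root16_ge; (move: x_ge1; lra').
have l1 : 1 <= l ^+ 2 by rewrite exprn_ege1//; (move: x_ge1; lra').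
by rewrite mulrA ler_peMl ?exprn_ge0 ?(ltW y0)// mulr_ege1.
Qed.

(** As [n / x >= 2 * l], a coarse cell is missed with probability at most [n ^ (-2)], and
    [x <= n]. *)
Let some_empty_le : x * (1 - x^-1) ^+ n <= t.
Proof.
have h1 : (1 - x^-1) ^+ n <= expR (- (n%:R * x^-1)).
  by apply: expr_1B_le_expR; rewrite invr_ge0 (ltW x0) invf_le1.
have h2 : expR (- (n%:R * x^-1)) <= n%:R^-1 * n%:R^-1.
  rewrite -n_inv -expRD ler_expR -opprD lerN2 ler_pdivlMr//.
  by have := x_le; (move: x_ge1; lra').
apply: le_trans n_inv_le.
apply: (@le_trans _ _ (x * (n%:R^-1 * n%:R^-1))).
  by rewrite ler_pM2l//; exact: le_trans h1 h2.
rewrite mulrA ler_piMl ?invr_ge0// ler_pdivrMr ?large_n_gt0// mul1r.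
apply: le_trans x_le; rewrite ler_peMr//; (move: x_ge1; lra').
Qed.

Let few_empties_le : 4 / mu <= t.
Proof.
have mu0 : 0 < mu by apply: lt_le_trans mu_ge; rewrite divr_gt0// mulr_gt0// exprn_gt0.
apply: (@le_trans _ _ (4 / (8 * y ^+ 12 / l))).
  rewrite ler_pM2l// lef_pV2 ?posrE//.
  by rewrite divr_gt0// mulr_gt0// exprn_gt0.
have -> : 4 / (8 * y ^+ 12 / l) = l / (2 * y ^+ 12) by field; rewrite !gt_eqF.
rewrite t_eq sqrt_root16 ler_pdivrMr ?mulr_gt0 ?exprn_gt0//.
have -> : l ^+ 2 / y ^+ 8 * (2 * y ^+ 12) = 2 * l * y ^+ 4 * l by field; rewrite gt_eqF.
have y4 : 1 <= y ^+ 4 by rewrite exprn_ege1//; have := root16_ge; (move: x_ge1; lra').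
rewrite ler_peMl ?(ltW l0)//; have := l_ge; nra'.
Qed.

(** The hitting probability per round is at least [y ^ -4 / 36]; over at least [y ^ 8 * l] rounds
    the exponent exceeds [l]. *)
Let no_cand_le : (1 - mu / 4 / (576 * x)) ^+ (n - N1) <= t.
Proof.
have qle : (1 - (64 * x)^-1) ^+ N1 <= 1.
  have h : (64 * x)^-1 <= 1 by rewrite invf_le1; (move: x_ge1; lra').
  by rewrite exprn_ile1// ?gerBl ?invr_ge0 ?subr_ge0//; (move: x_ge1; lra').
set q := (1 - (64 * x)^-1) ^+ N1 in qle.
have -> : mu / 4 / (576 * x) = q / 36 by rewrite mu_eq -/q; field; rewrite gt_eqF.
have q0 : 0 <= q by apply: le_trans q_ge; rewrite invr_ge0 exprn_ge0 ?ltW.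
apply: le_trans (expr_1B_le_expR _ _) _; first by apply/andP; split; (move: x_ge1; lra').
apply: le_trans n_inv_le; rewrite -n_inv ler_expR lerN2.
apply: (@le_trans _ _ (y ^+ 8 * l * ((y ^+ 4)^-1 / 36))); last first.
  apply: ler_pM => //.
  - by rewrite mulr_ge0 ?exprn_ge0 ?ltW.
  - by rewrite divr_ge0 ?invr_ge0 ?exprn_ge0 ?ltW.
  - by rewrite -sqrt_root16.
  - by rewrite ler_pM2r ?invr_gt0//; exact: q_ge.
have -> : y ^+ 8 * l * ((y ^+ 4)^-1 / 36) = y ^+ 4 / 36 * l by field; rewrite gt_eqF.
rewrite ler_peMl ?(ltW l0)// ler_pdivlMr// mul1r.
have := root16_ge; have -> : y ^+ 4 = y * y ^+ 3 by rewrite exprS.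
have : 1 <= y ^+ 3 by rewrite exprn_ege1//; have := root16_ge; (move: x_ge1; lra').
have -> : y ^+ 3 = y * y ^+ 2 by rewrite exprS.
have : 1 <= y ^+ 2 by rewrite exprn_ege1//; have := root16_ge; (move: x_ge1; lra').
nra'.
Qed.

Let collision_le : (n - N1)%:R * (25 / (576 * x)) <= t.
Proof.
apply: (@le_trans _ _ (2 * y ^+ 8 * l * (25 / (576 * (y ^+ 16 / (8 * l)))))).
  have := xy_ge; have : 0 < y ^+ 16 / (8 * l) by rewrite divr_gt0 ?exprn_gt0 ?mulr_gt0.
  move: (y ^+ 16 / (8 * l)) => a a0 ax; apply: ler_pM.
  - exact: ler0n.
  - by apply: divr_ge0 (ler0n _ _) (mulr_ge0 (ler0n _ _) (ltW x0)).
  - exact: late_le2.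
  - have c0 : 0 < 576 :> R by rewrite ltr0n.
    rewrite ler_pM2l ?ltr0n// lef_pV2 ?posrE; [|exact: mulr_gt0..].
    by rewrite ler_pM2l.
have -> : 2 * y ^+ 8 * l * (25 / (576 * (y ^+ 16 / (8 * l)))) = 400 / 576 * t.
  by rewrite t_eq sqrt_root16; field; rewrite !gt_eqF.
have : 0 <= t by rewrite t_eq divr_ge0 ?exprn_ge0 ?ltW.
(move: x_ge1; lra').
Qed.

Lemma total_failure_le :
  (n - N1)%:R * (25 / (576 * x)) + (x * (1 - x^-1) ^+ n +
    (4 / mu + (1 - mu / 4 / (576 * x)) ^+ (n - N1))) <= 4 * t.
Proof.
have := collision_le; have := some_empty_le; have := few_empties_le.
by have := no_cand_le; (move: x_ge1; lra').
Qed.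

End Asymptotics.

(** * Choice of the grid size *)

Section GridSize.
Variable R : realType.

Definition grid_size (n : nat) : nat :=
  Num.truncn (Num.sqrt (n%:R / (2 * ln n%:R)) : R).

(** Truncating a real that is at least 1 loses less than a factor 2, hence a factor 4 in the square,
    which turns 2 into 8. *)
Lemma grid_size_bounds n (l : R) : l = ln n%:R -> 240 <= l ->
  [/\ (0 < grid_size n)%N, (grid_size n ^ 2)%:R * (2 * l) <= n%:R &
    n%:R <= 8 * l * (grid_size n ^ 2)%:R].
Proof.
move=> lE l240; have l0 : 0 < l by lra.
have nE : n%:R = expR l.
  by rewrite lE lnK// posrE ltr0n lt0n; apply: contraPneq l240 => n0; rewrite lE n0 ln0//; lra.
rewrite /grid_size -lE; set z := n%:R / (2 * l); set r := Num.sqrt z.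
have z1 : 1 <= z.
  rewrite /z ler_pdivlMr ?mulr_gt0// mul1r nE.
  have := expR_ge1Dx (l / 2); have -> : expR l = expR (l / 2) ^+ 2.
    by rewrite -expRM_natr divfK.
  by move: (expR (l / 2)) => e; rewrite expr2; nra.
have r2 : r ^+ 2 = z by rewrite sqr_sqrtr//; lra.
have r0 : 0 <= r by exact: sqrtr_ge0.
have r1 : 1 <= r by rewrite -sqrtr1 ler_wsqrtr.
have /andP[M1 M2] := truncn_itv r0.
have M0 : (0 < Num.truncn r)%N by rewrite truncn_gt0.
have MR : 1 <= (Num.truncn r)%:R :> R by rewrite ler1n.
have zl : z * (2 * l) = n%:R by rewrite divfK// gt_eqF// mulr_gt0.
rewrite natrX; rewrite -natr1 in M2.
move: (Num.truncn r)%:R M1 M2 MR => M M1 M2 MR; split=> //.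
  rewrite -zl -r2 ler_pM2r ?mulr_gt0// !expr2; nra.
rewrite -zl -r2.
have -> : 8 * l * M ^+ 2 = (4 * M ^+ 2) * (2 * l) by ring.
by rewrite ler_pM2r ?mulr_gt0// !expr2; nra.
Qed.

End GridSize.

Theorem theorem4p1 (R : realType) :
  exists c : R, 0 < c /\
  exists (k1 k2 : R) (rad : nat -> R), 0 < k1 /\ 0 < k2 /\
  exists (alpha beta C : R), 0 < alpha /\ 0 < beta /\ 0 < C /\
  exists N : nat, forall n : nat, (N <= n)%N ->
    k1 * Num.sqrt (ln n%:R / n%:R) <= rad n <=
      k2 * Num.sqrt (ln n%:R / n%:R) /\
    ((1 - C * (ln n%:R ^+ 2 / Num.sqrt n%:R))%:E <=
      prob_unif n
        (good_event n (c * Num.sqrt n%:R * ln n%:R) (rad n) alpha beta))%E.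
Proof.
exists 1; split=> //.
(* The radius is [1 / (48 * M)], and [M * sqrt (ln n / n)] lies between [1 / 3] and 1. *)
exists (48^-1), (3 / 48), (fun n => (2 * (grid_size R n * 8 * 3)%:R)^-1).
do 2![split; first by lra].
(* [rad / 6 = 1 / (288 * M)] gives [alpha], [(12 / M) ^ 2] with [n <= 8 * l * M ^ 2] gives [beta],
   and four failure terms, each at most [t], give [C]. *)
exists (288^-1 ^+ 2), (8 * 144), 4.
split; first by rewrite exprn_gt0// invr_gt0.
do 2![split; first by lra].
exists (Num.truncn (expR 240 : R)).+1 => n Nn.
have nN : expR 240 <= n%:R :> R.
  have /andP[_ h] := truncn_itv (expR_ge0 (240 : R)).
  by apply: le_trans (ltW h) _; rewrite ler_nat.
have n0 : 0 < n%:R :> R by apply: lt_le_trans nN; exact: expR_gt0.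
pose l : R := ln n%:R; have lE : l = ln n%:R by [].
have l240 : 240 <= l by rewrite lE -(expRK 240) ler_ln ?posrE ?expR_gt0.
have [M0 x_le x_ge] := grid_size_bounds lE l240.
rewrite -lE; clearbody l; set M := grid_size R n in M0 x_le x_ge *.
have M1 : 1 <= M%:R :> R by rewrite ler1n.
have x1 : 1 <= (M ^ 2)%:R :> R by rewrite ler1n expn_gt0 M0.
have l0 : 0 < l by lra.
have radE : (2 * (M * 8 * 3)%:R)^-1 = (48 * M%:R)^-1 :> R.
  by congr (_^-1); rewrite !natrM; ring.
split.
  rewrite radE; set sg := Num.sqrt _.
  have sg0 : 0 <= sg by exact: sqrtr_ge0.
  have sg2 : sg ^+ 2 * n%:R = l by rewrite sqr_sqrtr ?divfK ?gt_eqF// divr_ge0 ?ltW.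
  have lo : M%:R * sg <= 1.
    have : (M%:R * sg) ^+ 2 <= 1.
      rewrite exprMn -(ler_pM2r n0) mul1r -mulrA sg2 -natrX; move: x_le; nra.
    by move: (M%:R * sg) => u; rewrite expr2; nra.
  have hi : 1 <= 3 * (M%:R * sg).
    have : 1 <= (3 * (M%:R * sg)) ^+ 2.
      rewrite 2!exprMn -(ler_pM2r n0) mul1r -mulrA -(mulrA (M%:R ^+ 2)) sg2 -natrX; move: x_ge; nra.
    have : 0 <= M%:R * sg by rewrite mulr_ge0.
    by move: (M%:R * sg) => u; rewrite expr2; nra.
  have M48 : 0 < 48 * M%:R :> R by lra.
  apply/andP; split.
    by rewrite -[leRHS]mul1r ler_pdivlMr//; lra.
  by rewrite -[leLHS]mul1r ler_pdivrMr//; lra.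
rewrite mul1r.
set f := Num.sqrt n%:R * l.
pose y := expR (l / 16).
have yE : y = expR (l / 16) by [].
have y16 := root16_ge yE l240.
have nl : n%:R = y ^+ 16 by exact: root16_exp lE yE l240.
have sl : Num.sqrt n%:R = y ^+ 8 by exact: sqrt_root16 lE yE erefl l240.
have ly := ln_le_root16 yE.
clearbody y.
have y8 : 16 <= y ^+ 8.
  by apply: le_trans y16 _; rewrite exprS ler_peMr ?exprn_ege1//; lra.
have f0 : 0 <= f by rewrite mulr_ge0 ?sqrtr_ge0 ?ltW.
have f_n : f <= n%:R.
  rewrite /f sl nl (exprD y 8 8) ler_pM2l ?exprn_gt0//; try lra.
  have -> : y ^+ 8 = y * y ^+ 7 by rewrite exprS.
  have : 16 <= y ^+ 7.
    by apply: le_trans y16 _; rewrite exprS ler_peMr ?exprn_ege1//; lra.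
  nra.
have nf0 : 0 <= n%:R - f by lra.
(* Rounding down makes [n - f < i] equivalent to [N1 < i] for integers [i]. *)
pose N1 := Num.truncn (n%:R - f).
have /andP[N1a N1b] := truncn_itv nf0; rewrite -/N1 in N1a N1b.
have N1n : (N1 <= n)%N by rewrite -(ler_nat R); lra.
have late : (n - N1)%:R = n%:R - N1%:R :> R by rewrite natrB.
have f_late (i : nat) : n%:R - f < i%:R <-> (N1 < i)%N.
  split=> h; first by rewrite -(ltr_nat R); lra.
  by apply: lt_le_trans N1b _; rewrite ler_nat.
rewrite -natr1 in N1b.
pose mu : R := 64 * (M ^ 2)%:R * (1 - (64 * (M ^ 2)%:R)^-1) ^+ N1.
have late1 : Num.sqrt n%:R * l <= (n - N1)%:R by rewrite late -/f; lra.
have late2 : (n - N1)%:R <= Num.sqrt n%:R * l + 1 by rewrite late -/f; lra.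
have muE : mu = 64 * (M ^ 2)%:R * (1 - (64 * (M ^ 2)%:R)^-1) ^+ N1 by [].
have mu_late : (n - N1)%:R <= mu / 4.
  exact: late_le_mu lE yE erefl muE l240 x_ge x1 N1n late2.
have total := total_failure_le lE yE erefl muE erefl l240 x_le x_ge x1 N1n late1 late2.
have mE : ((M * 8) ^ 2)%:R = 64 * (M ^ 2)%:R :> R by rewrite expnMn mulnC natrM.
have LE : ((M * 8 * 3) ^ 2)%:R = 576 * (M ^ 2)%:R :> R.
  by rewrite -mulnA expnMn mulnC natrM.
apply: le_trans (@good_event_prob_ge R M n N1 f _ _ M0 N1n f_late _ _ _).
- by rewrite lee_fin mE LE -/mu; lra.
- rewrite -lE radE.
  have -> : ((48 * M%:R)^-1 / 6) ^+ 2 = 288^-1 ^+ 2 * (M ^ 2)%:R^-1 :> R.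
    by rewrite natrX; field; rewrite gt_eqF//; lra.
  rewrite ler_pM2l ?exprn_gt0 ?invr_gt0// ler_pdivrMr// mulrC ler_pdivlMr; last lra.
  by rewrite mulrC; move: x_le; nra.
- rewrite -lE.
  have -> : (12 / M%:R) ^+ 2 = 144 * (M ^ 2)%:R^-1 :> R.
    by rewrite natrX; field; rewrite gt_eqF//; lra.
  rewrite (mulrC 8) -mulrA ler_pM2l// mulrA ler_pdivlMr// mulrC ler_pdivrMr//; lra.
- by rewrite mE.
Qed.
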